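(* Let $X$ be a two-sided quaternionic Banach space and $T\in\mathcal{B}(X)$. The following three statements are equivalent: (i) $T$ is power-bounded, i.e. $\sup_{n\in\mathbb{N}}\|T^n\|<\infty$; (ii) every $s\in\mathbb{H}$ with $|s|>1$ lies in $\rho_S(T)$, and there exists a constant $C>0$ such that $$\|\mathcal{Y}_L^n(s,T)\|\le\frac{C}{(1-\frac{1}{|s|})^n}\quad\text{for all } s\in\mathbb{H} \text{ with } |s|>1 \text{ and all } n\in\mathbb{N};$$ (iii) every $s\in\mathbb{H}$ with $|s|>1$ lies in $\rho_S(T)$, and there exists a constant $C>0$ such that $$\|\mathcal{Y}_R^n(s,T)\|\le\frac{C}{(1-\frac{1}{|s|})^n}\quad\text{for all } s\in\mathbb{H} \text{ with } |s|>1 \text{ and all } n\in\mathbb{N}.$$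
   Context: $\mathbb{N}$ is the set of positive integers. $\mathbb{H}$ denotes the real algebra of quaternions; for $s\in\mathbb{H}$, $\overline{s}$ is its conjugate, $\mathrm{Re}(s)$ its real part, $|s|$ its modulus. $X$ is a two-sided vector space over $\mathbb{H}$ which is a Banach space; $\mathcal{B}(X)$ is the algebra of bounded right $\mathbb{H}$-linear operators on $X$ with identity $\mathcal{I}$ and operator norm; $(sT)(v)=s(Tv)$, $(Ts)(v)=T(sv)$. For $s\in\mathbb{H}$ put $Q_s(T)=T^2-2\mathrm{Re}(s)T+|s|^2\mathcal{I}$; $\rho_S(T)=\{s\in\mathbb{H}: Q_s(T)\text{ invertible in }\mathcal{B}(X)\}$. For $s\in\rho_S(T)$ and $n\in\mathbb{N}$ define $$S_L^{-n}(s,T)=Q_s(T)^{-n}\sum_{m=0}^{n}\binom{n}{m}(-T)^m\overline{s}^{\,n-m},\qquad S_R^{-n}(s,T)=\sum_{m=0}^{n}\binom{n}{m}\overline{s}^{\,n-m}(-T)^mQ_s(T)^{-n},$$ and the (powers of the) left and right spherical Yosida approximations $$\mathcal{Y}_L^n(s,T)=T^nS_L^{-n}(s,T)s^n,\qquad \mathcal{Y}_R^n(s,T)=s^nS_R^{-n}(s,T)T^n.$$ *)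

(* Defs.v *)
From HB Require Import structures.
From mathcomp Require Import all_boot all_order all_algebra.
From mathcomp Require Import all_classical all_reals all_analysis.
Set Implicit Arguments. Unset Strict Implicit. Unset Printing Implicit Defensive.
Import Order.TTheory GRing.Theory Num.Theory.
Import numFieldNormedType.Exports.
Local Open Scope ring_scope.

Record quat (R : Type) := Quat { q0 : R; q1 : R; q2 : R; q3 : R }.

Section Quat.
Variable R : realType.
Definition qreal (r : R) : quat R := Quat r 0 0 0.
Definition qone : quat R := qreal 1.
Definition qadd (p q : quat R) : quat R :=
  Quat (q0 p + q0 q) (q1 p + q1 q) (q2 p + q2 q) (q3 p + q3 q).
Definition qmul (p q : quat R) : quat R :=
  Quat (q0 p * q0 q - q1 p * q1 q - q2 p * q2 q - q3 p * q3 q)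
       (q0 p * q1 q + q1 p * q0 q + q2 p * q3 q - q3 p * q2 q)
       (q0 p * q2 q - q1 p * q3 q + q2 p * q0 q + q3 p * q1 q)
       (q0 p * q3 q + q1 p * q2 q - q2 p * q1 q + q3 p * q0 q).
Definition qconj (p : quat R) : quat R := Quat (q0 p) (- q1 p) (- q2 p) (- q3 p).
Definition qRe (p : quat R) : R := q0 p.
Definition qnorm (p : quat R) : R :=
  Num.sqrt (q0 p ^+ 2 + q1 p ^+ 2 + q2 p ^+ 2 + q3 p ^+ 2).
Fixpoint qexp (p : quat R) (n : nat) : quat R :=
  match n with O => qone | S k => qmul p (qexp p k) end.
End Quat.

(** * Two-sided quaternionic Banach spaces.
    X is a real Banach space (completeNormedModType R) equipped with a left
    action [lm] and a right action [rm] of the quaternions making it a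
    two-sided H-vector space (real scalars acting centrally, i.e. through the
    underlying real structure), whose norm satisfies
    ||s v|| = ||v s|| = |s| ||v||. *)
Record qbanach (R : realType) (X : completeNormedModType R) := QBanach {
  lm : quat R -> X -> X;
  rm : X -> quat R -> X;
  lmDl : forall p q v, lm (qadd p q) v = lm p v + lm q v;
  lmDr : forall p u v, lm p (u + v) = lm p u + lm p v;
  lmA : forall p q v, lm (qmul p q) v = lm p (lm q v);
  rmDl : forall u v q, rm (u + v) q = rm u q + rm v q;
  rmDr : forall v p q, rm v (qadd p q) = rm v p + rm v q;
  rmA : forall v p q, rm v (qmul p q) = rm (rm v p) q;
  lm_real : forall (r : R) v, lm (qreal r) v = r *: v;
  rm_real : forall (r : R) v, rm v (qreal r) = r *: v;
  lmrmA : forall p q v, lm p (rm v q) = rm (lm p v) q;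
  norm_lm : forall p v, `|lm p v| = qnorm p * `|v|;
  norm_rm : forall p v, `|rm v p| = qnorm p * `|v|
}.

Section Ops.
Variables (R : realType) (X : completeNormedModType R) (QX : qbanach X).

Definition is_bop (T : X -> X) : Prop :=
  (forall u v, T (u + v) = T u + T v) /\
  (forall v q, T (rm QX v q) = rm QX (T v) q) /\
  (exists M : R, forall v, `|T v| <= M * `|v|).

Definition opbound (A : X -> X) (K : R) : Prop := forall v, `|A v| <= K * `|v|.

Definition Qs (s : quat R) (T : X -> X) : X -> X :=
  fun v => T (T v) - (2 * qRe s) *: T v + (qnorm s ^+ 2) *: v.

Definition is_inverse (A B : X -> X) : Prop :=
  is_bop B /\ (forall v, B (A v) = v) /\ (forall v, A (B v) = v).

Definition in_rhoS (s : quat R) (T : X -> X) : Prop :=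
  exists B, is_inverse (Qs s T) B.

(** S_L^{-n}(s,T) = Q_s(T)^{-n} sum_m C(n,m) (-T)^m sbar^{n-m},
    where [Qinv] is Q_s(T)^{-1} and (T s)(v) = T(s v). *)
Definition SLn (Qinv : X -> X) (n : nat) (s : quat R) (T : X -> X) : X -> X :=
  fun v => iter n Qinv
    (\sum_(m < n.+1) (('C(n, m))%:R * (-1) ^+ m) *:
        iter m T (lm QX (qexp (qconj s) (n - m)) v)).

(** S_R^{-n}(s,T) = sum_m C(n,m) sbar^{n-m} (-T)^m Q_s(T)^{-n},
    where (s T)(v) = s (T v). *)
Definition SRn (Qinv : X -> X) (n : nat) (s : quat R) (T : X -> X) : X -> X :=
  fun v => \sum_(m < n.+1) (('C(n, m))%:R * (-1) ^+ m) *: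
        lm QX (qexp (qconj s) (n - m)) (iter m T (iter n Qinv v)).

Definition YLn (Qinv : X -> X) (n : nat) (s : quat R) (T : X -> X) : X -> X :=
  fun v => iter n T (SLn Qinv n s T (lm QX (qexp s n) v)).

Definition YRn (Qinv : X -> X) (n : nat) (s : quat R) (T : X -> X) : X -> X :=
  fun v => lm QX (qexp s n) (SRn Qinv n s T (iter n T v)).
End Ops.

(* Main.v *)
(** (i) => (ii), (iii): for [|s| > 1], [Q_s(T) = E_sbar E_s] with
    [E_s v = v s - T v]; right multiplication commutes with [T], so [E_s] is
    inverted by the Neumann series of [v |-> (T v) s^-1], whose powers decay
    like [M |s|^-k].  The approximations satisfy
      [Y_L^(n+1) - T Y_L^(n+1) s^-1 = T Y_L^n]  and
      [Y_R^(n+1) - s^-1 Y_R^(n+1) T = Y_R^n T],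
    so in the seminorm [sup_j |T^j A|] (resp. [sup_j |A T^j|]), in which
    composing with [T] is a contraction, each step costs a factor
    [1 / (1 - 1/|s|)].
    (ii), (iii) => (i): at a real point [r > 1] both approximations equal
    [r^n T^n (r - T)^-n], hence [|T^n| <= C ((r + |T|) / (r - 1))^n]; let
    [r] tend to infinity. *)
Require Import Defs.
From HB Require Import structures.
From mathcomp Require Import all_boot all_order all_algebra.
From mathcomp Require Import all_classical all_reals all_analysis.
From mathcomp Require Import ring.
Import Order.TTheory GRing.Theory Num.Theory.
Import numFieldNormedType.Exports.
Local Open Scope ring_scope.

Set Implicit Arguments.
Unset Strict Implicit.
Unset Printing Implicit Defensive.

(** * Quaternion arithmetic *)

Section Quaternions.
Variable R : realType.
Implicit Types (p q s : quat R) (r : R).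

Lemma qmulA p q s : qmul p (qmul q s) = qmul (qmul p q) s.
Proof. by case: p q s => ???? [????] [????]; congr Quat; rewrite /=; ring. Qed.

Lemma qmul_qreal r q : qmul (qreal r) q = qmul q (qreal r).
Proof. by case: q => ????; congr Quat; rewrite /=; ring. Qed.

Lemma qreal_mul r r' : qmul (qreal r) (qreal r') = qreal (r * r').
Proof. by congr Quat; rewrite /=; ring. Qed.

Lemma sqr_qnorm q :
  qnorm q ^+ 2 = q0 q ^+ 2 + q1 q ^+ 2 + q2 q ^+ 2 + q3 q ^+ 2.
Proof. by rewrite sqr_sqrtr // !addr_ge0 ?sqr_ge0. Qed.

Lemma qmul_conj q : qmul q (qconj q) = qreal (qnorm q ^+ 2).
Proof. by rewrite sqr_qnorm; congr Quat; rewrite /=; ring. Qed.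

Lemma qmul_conjl q : qmul (qconj q) q = qreal (qnorm q ^+ 2).
Proof. by rewrite sqr_qnorm; congr Quat; rewrite /=; ring. Qed.

Lemma qadd_conj q : qadd q (qconj q) = qreal (2 * qRe q).
Proof. by congr Quat; rewrite /= /qRe; ring. Qed.

Lemma qnorm_conj q : qnorm (qconj q) = qnorm q.
Proof. by rewrite /qnorm /= !sqrrN. Qed.

Lemma qconj_qreal r : qconj (qreal r) = qreal r.
Proof. by rewrite /qconj /= oppr0. Qed.

Lemma qnorm_qreal r : 0 <= r -> qnorm (qreal r) = r.
Proof. by move=> r0; rewrite /qnorm /= expr0n !addr0 sqrtr_sqr ger0_norm. Qed.

Lemma qexpSr q n : qexp q n.+1 = qmul (qexp q n) q.
Proof.
elim: n => [|n IH]; first by rewrite /= /qone qmul_qreal.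
by rewrite [LHS]/= -/(qexp q n.+1) [in LHS]IH /= qmulA.
Qed.

Lemma qexp_qreal r n : qexp (qreal r) n = qreal (r ^+ n).
Proof. by elim: n => [|n IH] //=; rewrite IH qreal_mul exprS. Qed.

End Quaternions.

(** Pascal's rule, with the shifted half reindexed so that both sums run over level [n]; it drives
    the recursions [numLS] and [numRS]. *)
Lemma binomial_sumS (R : pzRingType) (V : lmodType R) (F : nat -> nat -> V) n :
  \sum_(m < n.+2) 'C(n.+1, m)%:R *: F m (n.+1 - m)%N =
  \sum_(m < n.+1) 'C(n, m)%:R *: F m (n - m).+1 +
  \sum_(m < n.+1) 'C(n, m)%:R *: F m.+1 (n - m)%N.
Proof.
rewrite big_ord_recl /= bin0 subn0.
under eq_bigr => i _ do
  rewrite /bump leq0n add1n binS subSS natrD scalerDl.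
rewrite big_split /= addrA; congr (_ + _).
rewrite big_ord_recr /= bin_small // scale0r addr0.
rewrite [RHS]big_ord_recl /= bin0 subn0; congr (_ + _).
by apply: eq_bigr => i _; rewrite /bump leq0n add1n subnSK.
Qed.

(** * Limits of geometric bounds *)

Section GeometricBounds.
Variable R : realType.

Lemma ler_geometric_limit (a b c x : R) : 0 <= x < 1 ->
  (forall n, a <= b + c * x ^+ n) -> a <= b.
Proof.
move=> /andP[x0 x1] h.
have hx : `|x| < 1 by rewrite ger0_norm.
have hl : ((b + c * x ^+ n) @[n --> \oo] --> b + 0)%classic.
  by apply: cvgD; [exact: cvg_cst | exact: (cvg_geometric c hx)].
rewrite -[b]addr0; apply: ler_cvg_to (cvg_cst a) hl _.
by apply: nearW => n; exact: h.
Qed.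

(** The map $K \mapsto c + xK$ contracts by $x$ towards its fixed point $c/(1-x)$, so iterating it
    from any finite [K0] and passing to the limit removes [K0]. *)
Lemma self_improving_bound (I : Type) (f g : I -> R) (c x K0 : R) :
  0 <= x < 1 ->
  (forall K, (forall i, f i <= K * g i) ->
     forall i, f i <= (c + x * K) * g i) ->
  (forall i, f i <= K0 * g i) ->
  forall i, f i <= c / (1 - x) * g i.
Proof.
move=> hx step h0.
have x1 : 1 - x != 0 by case/andP: hx => _ ?; rewrite subr_eq0 gt_eqF.
set d := c / (1 - x).
have hn n : forall i, f i <= (d + x ^+ n * (K0 - d)) * g i.
  elim: n => [|n IH] i; first by rewrite expr0 mul1r addrC subrK.
  have := step _ IH i; congr (_ <= _ * _).
  by rewrite /d exprS; field.
move=> i; apply: (@ler_geometric_limit _ _ ((K0 - d) * g i) _ hx) => n.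
apply: le_trans (hn n i) _; rewrite le_eqVlt; apply/orP; left; apply/eqP.
by ring.
Qed.

Lemma geometric_sum_le (x : R) n : 0 <= x < 1 ->
  \sum_(k < n) x ^+ k <= (1 - x)^-1.
Proof.
case/andP=> x0 x1; have hx : 0 < 1 - x by rewrite subr_gt0.
rewrite -[leRHS]mul1r ler_pdivlMr // mulrC.
by rewrite -opprB mulNr -subrX1 opprB lerBlDr lerDl exprn_ge0.
Qed.

End GeometricBounds.

Lemma iter_linear (R : pzRingType) (V : lmodType R) (f : {linear V -> V}) n :
  linear (iter n f).
Proof. by move=> a u v; elim: n => //= n ->; rewrite linearP. Qed.

HB.instance Definition _ (R : pzRingType) (V : lmodType R)
    (f : {linear V -> V}) n :=
  GRing.isLinear.Build R V V *:%R (iter n f) (iter_linear f n).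

(** * Neumann series under geometric decay of the powers *)

Section Neumann.
Variables (R : realType) (X : completeNormedModType R) (g : {linear X -> X}).
Variables (M x : R).
Hypotheses (M0 : 0 <= M) (hx : 0 <= x < 1).
Hypothesis hg : forall k v, `|iter k g v| <= M * x ^+ k * `|v|.

(** Telescoping writes [v] as a partial Neumann sum of [v - g v] plus the remainder [iter n g v],
    which tends to zero. *)
Lemma neumann_bound v : `|v| <= M / (1 - x) * `|v - g v|.
Proof.
apply: (@ler_geometric_limit _ _ _ (M * `|v|) x hx) => n.
have E : v = \sum_(k < n) iter k g (v - g v) + iter n g v.
  under eq_bigr => k _ do rewrite linearB /= -iterSr.
  elim: n => [|n IH]; first by rewrite big_ord0 add0r.
  by rewrite big_ord_recr /= -addrA subrK.
rewrite [in leLHS]E; apply: le_trans (ler_normD _ _) _; apply: lerD; last first.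
  by apply: le_trans (hg _ _) _; rewrite mulrAC.
apply: le_trans (ler_norm_sum _ _ _) _.
apply: (@le_trans _ _ (\sum_(k < n) M * x ^+ k * `|v - g v|)).
  by apply: ler_sum => k _; exact: hg.
rewrite -mulr_suml -mulr_sumr ler_wpM2r // ler_wpM2l //.
exact: geometric_sum_le.
Qed.

(** Completeness of [X] provides the sum of $\sum_k g^k w$, and this sum is the required [v]. *)
Lemma neumann_surj w : exists v, v - g v = w.
Proof.
have hx' : `|x| < 1 by case/andP: hx => x0 x1; rewrite ger0_norm.
pose u k := iter k g w.
have cu : cvgn (series u).
  apply: normed_cvg.
  apply: (@series_le_cvg _ _ (geometric (M * `|w|) x)) => [n|n|n|].
  - exact: normr_ge0.
  - by rewrite /= !mulr_ge0 ?exprn_ge0 //; case/andP: hx.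
  - by apply: le_trans (hg _ _) _; rewrite /= mulrAC.
  - exact: is_cvg_geometric_series.
set v := limn (series u).
exists v; apply/eqP; rewrite -subr_eq0 -normr_le0.
pose e n := `|v - series u n|.
have e0 : (e n @[n --> \oo] --> 0)%classic.
  have : (v - series u n @[n --> \oo] --> v - v)%classic.
    by apply: cvgB; [exact: cvg_cst | exact: cu].
  by rewrite subrr => /norm_cvg0P.
have tel n : series u n - g (series u n) = w - iter n g w.
  rewrite /series /= big_mkord.
  elim: n => [|n IH]; first by rewrite big_ord0 linear0 !subrr.
  rewrite big_ord_recr /= linearD opprD addrACA IH.
  by rewrite addrA subrK.
(* The defect of [v] is compared with that of the [n]-th partial sum, which is $-g^n w$ by [tel];
   continuity of [g] enters as the case $k=1$ of [hg]. *)
have H n : `|v - g v - w| <= (1 + M * x) * e n + M * `|w| * x ^+ n.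
  have -> : v - g v - w =
      (v - series u n) - g (v - series u n) - iter n g w.
    rewrite -[iter n g w](subKr w) -tel linearB /=.
    rewrite [- (g v - _)]opprD addrACA -opprD.
    by rewrite [- (w - _)]opprB addrA subrK.
  apply: le_trans (ler_normB _ _) _; apply: lerD; last first.
    by apply: le_trans (hg _ _) _; rewrite mulrAC.
  apply: le_trans (ler_normB _ _) _; rewrite mulrDl mul1r lerD2l.
  by have := hg 1 (v - series u n); rewrite expr1.
have : `|v - g v - w| <= (1 + M * x) * 0 + 0.
  have hl : ((1 + M * x) * e n + M * `|w| * x ^+ n @[n --> \oo] -->
      (1 + M * x) * 0 + 0)%classic.
    apply: cvgD; last exact: (cvg_geometric _ hx').
    by apply: cvgM; [exact: cvg_cst | exact: e0].
  by apply: ler_cvg_to (cvg_cst _) hl _; apply: nearW => n; exact: H.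
by rewrite mulr0 addr0.
Qed.

End Neumann.

(** * Iterates and inverses of commuting maps *)

Lemma iter_comm (V : Type) (A B : V -> V) n v :
  (forall v, A (B v) = B (A v)) -> A (iter n B v) = iter n B (A v).
Proof. by move=> AB; elim: n => //= n <-; rewrite AB. Qed.

Lemma iter_comp (V : Type) (A B : V -> V) n v :
  (forall v, A (B v) = B (A v)) -> iter n (A \o B) v = iter n A (iter n B v).
Proof.
move=> AB; elim: n => //= n ->; congr (A _).
by rewrite iter_comm // => u; rewrite AB.
Qed.

Lemma iter_cancel (V : Type) (A B : V -> V) n :
  cancel A B -> cancel (iter n A) (iter n B).
Proof.
by move=> AB; elim: n => // n IH v; rewrite [iter n.+1 A v]/= iterSr AB IH.
Qed.

Lemma inverse_comm (V : Type) (A Q Qi : V -> V) :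
  cancel Q Qi -> cancel Qi Q -> (forall v, A (Q v) = Q (A v)) ->
  forall v, A (Qi v) = Qi (A v).
Proof.
move=> QK QiK AQ v.
by rewrite -[RHS](congr1 (Qi \o A) (QiK v)) /= AQ QK.
Qed.

(** * The quaternionic actions, bounded operators, and the numerators of $S_L^{-n}$ and
    $S_R^{-n}$ *)

Section QuaternionicModule.
Variables (R : realType) (X : completeNormedModType R) (QX : qbanach X).
Implicit Types (s p q : quat R) (r : R) (u v w : X).

Lemma lm_one v : lm QX (qone R) v = v.
Proof. by rewrite lm_real scale1r. Qed.

Lemma rm_one v : rm QX v (qone R) = v.
Proof. by rewrite rm_real scale1r. Qed.

Lemma lm_linear s : linear (lm QX s).
Proof.
move=> r u v; rewrite lmDr; congr (_ + _).
by rewrite -!(lm_real QX) -!lmA qmul_qreal.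
Qed.

HB.instance Definition _ s :=
  GRing.isLinear.Build R X X *:%R (lm QX s) (lm_linear s).

Definition rscale q v := rm QX v q.

Lemma rscale_linear q : linear (rscale q).
Proof.
move=> r u v; rewrite /rscale rmDl; congr (_ + _).
by rewrite -!(rm_real QX) -!rmA qmul_qreal.
Qed.

HB.instance Definition _ q :=
  GRing.isLinear.Build R X X *:%R (rscale q) (rscale_linear q).

(** Real scaling is right multiplication by a real quaternion, so right $\mathbb{H}$-linearity
    contains real linearity. *)
Lemma bop_linear (T : X -> X) : is_bop QX T -> linear T.
Proof. by move=> [TD [Trm _]] r u v; rewrite TD -!(rm_real QX) Trm. Qed.

Definition bounded_op (A : X -> X) := exists2 K : R, 0 <= K & opbound A K.

Lemma opbound_le (A : X -> X) K K' : K <= K' -> opbound A K -> opbound A K'.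
Proof. by move=> KK' hA v; apply: le_trans (hA v) _; rewrite ler_wpM2r. Qed.

Lemma bop_bounded (T : X -> X) : is_bop QX T -> bounded_op T.
Proof.
move=> [_ [_ [K hK]]]; exists (Num.max K 0); first by rewrite le_max lexx orbT.
by apply: opbound_le hK; rewrite le_max lexx.
Qed.

Lemma bounded_lm s : bounded_op (lm QX s).
Proof. by exists (qnorm s) => [|v]; rewrite ?sqrtr_ge0 ?norm_lm. Qed.

Lemma bounded_comp (A B : X -> X) :
  bounded_op A -> bounded_op B -> bounded_op (A \o B).
Proof.
move=> [K K0 hA] [L L0 hB]; exists (K * L) => [|v]; first exact: mulr_ge0.
by apply: le_trans (hA _) _; rewrite -mulrA ler_wpM2l.
Qed.

Lemma bounded_iter (A : X -> X) n : bounded_op A -> bounded_op (iter n A).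
Proof.
move=> hA; elim: n => [|n IH]; first by exists 1 => [|v] //=; rewrite mul1r.
exact: (bounded_comp hA IH).
Qed.

Lemma bounded_sub (A B : X -> X) :
  bounded_op A -> bounded_op B -> bounded_op (A \- B).
Proof.
move=> [K K0 hA] [L L0 hB]; exists (K + L) => [|v]; first exact: addr_ge0.
by apply: le_trans (ler_normB _ _) _; rewrite mulrDl lerD.
Qed.

Variable T : {linear X -> X}.

(** The sum in [SLn], that is $S_L^{-n}$ stripped of $Q_s(T)^{-n}$: formally the [n]-th power of
    $\bar s - T$ with all powers of [T] moved to the left. *)
Definition numL s n v : X :=
  \sum_(m < n.+1) (('C(n, m))%:R * (-1) ^+ m) *:
    iter m T (lm QX (qexp (qconj s) (n - m)) v).

Definition numR s n v : X :=
  \sum_(m < n.+1) (('C(n, m))%:R * (-1) ^+ m) *: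
    lm QX (qexp (qconj s) (n - m)) (iter m T v).

Lemma numL0 s v : numL s 0 v = v.
Proof. by rewrite /numL big_ord1 /= bin0 mulr1 scale1r lm_one. Qed.

Lemma numR0 s v : numR s 0 v = v.
Proof. by rewrite /numR big_ord1 /= bin0 mulr1 scale1r lm_one. Qed.

(** The order matters because [T] need not commute with the left action: the new $\bar s$ is applied
    first, the new [T] last. In [numRS] these positions are swapped. *)
Lemma numLS s n v :
  numL s n.+1 v = numL s n (lm QX (qconj s) v) - T (numL s n v).
Proof.
rewrite {1}/numL; under eq_bigr do rewrite -scalerA.
rewrite (binomial_sumS (fun i j =>
  (-1) ^+ i *: iter i T (lm QX (qexp (qconj s) j) v))).
rewrite linear_sum -sumrN; congr (_ + _); apply: eq_bigr => i _.
  by rewrite qexpSr lmA scalerA.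
by rewrite exprS mulN1r scaleNr scalerN scalerA [in RHS]linearZ.
Qed.

Lemma numRS s n v :
  numR s n.+1 v = lm QX (qconj s) (numR s n v) - numR s n (T v).
Proof.
rewrite {1}/numR; under eq_bigr do rewrite -scalerA.
rewrite (binomial_sumS (fun i j =>
  (-1) ^+ i *: lm QX (qexp (qconj s) j) (iter i T v))).
rewrite linear_sum -sumrN; congr (_ + _); apply: eq_bigr => i _.
  by rewrite [in RHS]linearZ /= lmA scalerA.
by rewrite iterSr exprS mulN1r scaleNr scalerN scalerA.
Qed.

Lemma bounded_numL s n : bounded_op T -> bounded_op (numL s n).
Proof.
move=> hT; elim: n => [|n IH].
  by exists 1 => [|v] //; rewrite numL0 mul1r.
have -> : numL s n.+1 = (numL s n \o lm QX (qconj s)) \- (T \o numL s n).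
  by apply/funext => v; rewrite numLS.
by apply: bounded_sub; apply: bounded_comp => //; exact: bounded_lm.
Qed.

Lemma bounded_numR s n : bounded_op T -> bounded_op (numR s n).
Proof.
move=> hT; elim: n => [|n IH].
  by exists 1 => [|v] //; rewrite numR0 mul1r.
have -> : numR s n.+1 = (lm QX (qconj s) \o numR s n) \- (numR s n \o T).
  by apply/funext => v; rewrite numRS.
by apply: bounded_sub; apply: bounded_comp => //; exact: bounded_lm.
Qed.

Lemma numL_linear s n : linear (numL s n).
Proof.
elim: n => [|n IH] r u v; first by rewrite !numL0.
by rewrite !numLS linearP !IH linearP opprD addrACA -scalerBr.
Qed.

Lemma numR_linear s n : linear (numR s n).
Proof.
elim: n => [|n IH] r u v; first by rewrite !numR0.
by rewrite !numRS linearP !IH linearP opprD addrACA -scalerBr.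
Qed.

HB.instance Definition _ s n :=
  GRing.isLinear.Build R X X *:%R (numL s n) (numL_linear s n).
HB.instance Definition _ s n :=
  GRing.isLinear.Build R X X *:%R (numR s n) (numR_linear s n).

Lemma lm_conj_lm s v : lm QX (qconj s) (lm QX s v) = qnorm s ^+ 2 *: v.
Proof. by rewrite -lmA qmul_conjl lm_real. Qed.

Lemma lm_lm_conj s v : lm QX s (lm QX (qconj s) v) = qnorm s ^+ 2 *: v.
Proof. by rewrite -lmA qmul_conj lm_real. Qed.

Lemma lmD_conj s v : lm QX s v + lm QX (qconj s) v = (2 * qRe s) *: v.
Proof. by rewrite -lmDl qadd_conj lm_real. Qed.

(** A formal product of $\bar s - T$ and $s - T$: $\bar s s$ gives $|s|^2$, and the two mixed terms
    combine through $s + \bar s = 2\mathrm{Re}(s)$, a real scalar that passes through [T]. *)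
Lemma numL_Qs s n v :
  numL s n.+1 (lm QX s v) - T (numL s n.+1 v) = Qs s T (numL s n v).
Proof.
rewrite !numLS lm_conj_lm /Qs -!linearZ -(lmD_conj s).
rewrite linearB !linearD /= !linearZ /=.
by rewrite opprK [RHS]addrC -addrA; congr (_ + _); rewrite [RHS]addrC addrA.
Qed.

Lemma numR_Qs s n v :
  lm QX s (numR s n.+1 v) - numR s n.+1 (T v) = numR s n (Qs s T v).
Proof.
rewrite !numRS linearB /= lm_lm_conj.
rewrite [in RHS]/Qs [in RHS]linearD [in RHS]linearB /=.
rewrite [numR s n (_ *: v)]linearZ [numR s n (_ *: T v)]linearZ /= -(lmD_conj s).
rewrite !opprD opprK [RHS]addrC -addrA; congr (_ + _).
by rewrite [RHS]addrC addrA.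
Qed.

Lemma Qs_comm s v : T (Qs s T v) = Qs s T (T v).
Proof. by rewrite /Qs linearD linearB /= !linearZ. Qed.

End QuaternionicModule.

(** * Power-bounded operators: the right resolvent and the Yosida bounds *)

Section PowerBounded.
Variables (R : realType) (X : completeNormedModType R) (QX : qbanach X).
Variables (T : {linear X -> X}) (M : R).
Hypothesis Trm : forall v q, T (rm QX v q) = rm QX (T v) q.
Hypothesis hT : bounded_op T.
Hypotheses (M0 : 0 <= M) (hM : forall n, opbound (iter n T) M).
Variable s : quat R.
Hypothesis hs : 1 < qnorm s.

Let x := (qnorm s)^-1.
(** The inverse $s^{-1} = \bar s/|s|^2$. *)
Let p := qmul (qconj s) (qreal (qnorm s ^- 2)).

Let s_gt0 : 0 < qnorm s. Proof. exact: lt_trans hs. Qed.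

Let s_neq0 : qnorm s != 0. Proof. by rewrite gt_eqF. Qed.

Let hx : 0 <= x < 1.
Proof. by rewrite /x invr_ge0 (ltW s_gt0) invf_lt1. Qed.

Let qmul_inv : qmul s p = qone R.
Proof. by rewrite /p qmulA qmul_conj qreal_mul divff // expf_neq0. Qed.

Let qmul_invl : qmul p s = qone R.
Proof.
by rewrite /p -qmulA qmul_qreal qmulA qmul_conjl qreal_mul divff // expf_neq0.
Qed.

Let norm_rm_inv v : `|rm QX v p| = x * `|v|.
Proof.
apply: (mulfI s_neq0); rewrite -(norm_rm QX) -rmA qmul_invl rm_one.
by rewrite mulrA mulfV // mul1r.
Qed.

Let norm_iter_inv k v : `|iter k (rscale QX p \o T) v| <= M * x ^+ k * `|v|.
Proof.
rewrite iter_comp => [|u]; last by rewrite /rscale Trm.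
have -> w : `|iter k (rscale QX p) w| = x ^+ k * `|w|.
  elim: k => [|k IH]; first by rewrite mul1r.
  by rewrite /= norm_rm_inv IH exprS mulrA.
rewrite mulrC -mulrA [x ^+ k * _]mulrC mulrA ler_wpM2r ?hM //.
by case/andP: hx => ? _; exact: exprn_ge0.
Qed.

(* [E_s] of the header: the right action is used because [T] need not commute
   with the left one. *)
Lemma right_resolvent : exists2 K : R, 0 <= K &
  (forall w, exists v, rm QX v s - T v = w) /\
  (forall v, `|v| <= K * `|rm QX v s - T v|).
Proof.
have x1 : 0 < 1 - x by rewrite subr_gt0; case/andP: hx.
(* The last factor [x] arises from $v - (Tv)s^{-1} = (vs - Tv)s^{-1}$. *)
exists (M / (1 - x) * x).
  by case/andP: hx => x0 _; rewrite mulr_ge0 // divr_ge0 // ltW.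
split=> [w|v].
  (* Solving $v - (Tv)s^{-1} = w s^{-1}$ and multiplying by $s$ on the right gives the claim. *)
  have [v hv] := neumann_surj M0 hx norm_iter_inv (rm QX w p).
  exists v; have := congr1 (rscale QX s) hv.
  by rewrite linearB /= /rscale -!rmA qmul_invl !rm_one.
apply: le_trans (neumann_bound M0 hx norm_iter_inv v) _.
rewrite -[leRHS]mulrA -norm_rm_inv -/(rscale QX p _) linearB /= /rscale.
by rewrite -rmA qmul_inv rm_one.
Qed.

(** Stated at $sw$ to avoid $s^{-1}$. Once [T] is moved past the inverses, [numL_Qs] merges the two
    numerators into a factor $Q_s(T)$, which cancels one of the $n+1$ inverses. *)
Lemma YL_step (Qi : {linear X -> X}) n w : cancel (Qs s T) Qi ->
    cancel Qi (Qs s T) ->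
  YLn QX Qi n.+1 s T (lm QX s w) - T (YLn QX Qi n.+1 s T w) =
  T (YLn QX Qi n s T (lm QX s w)).
Proof.
move=> QK QiK.
have TQi v : T (Qi v) = Qi (T v) by exact: (inverse_comm QK QiK (Qs_comm T s)).
rewrite /YLn /SLn -!/(numL QX T s _ _).
rewrite -[lm QX (qexp s n) _]lmA -qexpSr.
rewrite -[lm QX (qexp s n.+1) (lm _ _ _)]lmA -qexpSr [qexp s n.+2]/= lmA.
set u := lm QX (qexp s n.+1) w.
rewrite (iter_comm n.+1 (A := T) (B := T)) // (iter_comm n.+1 _ TQi).
rewrite -linearB -linearB /= numL_Qs.
by rewrite -[Qi (iter n Qi _)]iterS iterSr QK.
Qed.

Lemma YR_step (Qi : X -> X) n v : cancel (Qs s T) Qi ->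
    cancel Qi (Qs s T) ->
  lm QX s (YRn QX Qi n.+1 s T v) - YRn QX Qi n.+1 s T (T v) =
  lm QX s (YRn QX Qi n s T (T v)).
Proof.
move=> QK QiK.
have TQi w : T (Qi w) = Qi (T w) by exact: (inverse_comm QK QiK (Qs_comm T s)).
rewrite /YRn /SRn -!/(numR QX T s _ _).
rewrite -!lmA -/(qexp s n.+1) [qmul s (qexp s n.+1)](qexpSr s n.+1) lmA.
rewrite -linearB /=.
rewrite -!iterS -!iterSr.
set z := iter n.+1 Qi (iter n.+1 T v).
have -> : iter n.+1 Qi (iter n.+2 T v) = T z.
  by rewrite /z (iter_comm n.+1 _ TQi).
by rewrite numR_Qs /z iterS QiK.
Qed.

(* The bound concerns all [T^j Y^n v], so that the [T] in front of [Y^(n+1)] in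
   [YL_step] costs nothing: any bound [B] improves to [M / (1-x)^n + x B]. *)
Lemma YL_bound (Qi : {linear X -> X}) n :
  bounded_op Qi -> cancel (Qs s T) Qi -> cancel Qi (Qs s T) ->
  forall i : nat * X,
    `|iter i.1 T (YLn QX Qi n s T i.2)| <= M / (1 - x) ^+ n * `|i.2|.
Proof.
move=> hQi QK QiK; elim: n => [|n IH].
  move=> [j v] /=; rewrite /YLn /SLn -/(numL QX T s 0 _) numL0 lm_one.
  rewrite expr0 invr1 mulr1.
  exact: hM.
rewrite exprSr invfM mulrA.
(* The size of [K] is irrelevant: it only gives the self-improvement a finite start. *)
have [K K0 hK] : bounded_op (YLn QX Qi n.+1 s T).
  apply: (bounded_comp (bounded_iter _ hT)).
  apply: (bounded_comp (bounded_iter _ hQi)).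
  exact: (bounded_comp (bounded_numL _ _ _ hT) (bounded_lm _ _)).
apply: (@self_improving_bound _ _ _ _ _ _ (M * K) hx)
    => [B hB [j v]|[j v]] /=; last first.
  by apply: le_trans (hM _ _) _; rewrite -mulrA ler_wpM2l.
have [w ->] : exists w, v = lm QX s w.
  by exists (lm QX p v); rewrite -lmA qmul_inv lm_one.
have -> : YLn QX Qi n.+1 s T (lm QX s w) =
    T (YLn QX Qi n s T (lm QX s w)) + T (YLn QX Qi n.+1 s T w).
  by rewrite -YL_step // subrK.
rewrite linearD /= -[iter j T (T (YLn _ _ n _ _ _))]iterSr.
rewrite -[iter j T (T _)]iterSr; apply: le_trans (ler_normD _ _) _.
rewrite mulrDl lerD //; first exact: (IH (j.+1, lm QX s w)).
(* The gain [x] comes from $|w| = |sw|/|s|$. *)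
apply: le_trans (hB (j.+1, w)) _ => /=.
by rewrite norm_lm mulrACA mulVf // mul1r.
Qed.

(** In [YR_step] the extra [T] acts first, so the family is now $Y_R^n T^j v$; the gain [x] comes
    from the outer left factor $s$ instead of from the argument. *)
Lemma YR_bound (Qi : {linear X -> X}) n :
  bounded_op Qi -> cancel (Qs s T) Qi -> cancel Qi (Qs s T) ->
  forall i : nat * X,
    `|YRn QX Qi n s T (iter i.1 T i.2)| <= M / (1 - x) ^+ n * `|i.2|.
Proof.
move=> hQi QK QiK; elim: n => [|n IH].
  move=> [j v] /=; rewrite /YRn /SRn -/(numR QX T s 0 _) numR0 lm_one.
  by rewrite expr0 invr1 mulr1; exact: (hM j v).
rewrite exprSr invfM mulrA.
have [K K0 hK] : bounded_op (YRn QX Qi n.+1 s T).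
  apply: (bounded_comp (bounded_lm _ _)).
  apply: (bounded_comp (bounded_numR _ _ _ hT)).
  exact: (bounded_comp (bounded_iter _ hQi) (bounded_iter _ hT)).
apply: (@self_improving_bound _ _ _ _ _ _ (K * M) hx)
    => [B hB [j v]|[j v]] /=; last first.
  by apply: le_trans (hK _) _; rewrite -mulrA ler_wpM2l // hM.
rewrite -(ler_pM2l s_gt0) -(norm_lm QX).
rewrite -[lm QX s _](subrK (YRn QX Qi n.+1 s T (iter j.+1 T v))) YR_step //.
apply: le_trans (ler_normD _ _) _.
rewrite mulrA mulrDr mulrDl lerD //.
  by rewrite norm_lm -mulrA ler_pM2l //; exact: (IH (j.+1, v)).
by rewrite mulrA mulfV // mul1r; exact: (hB (j.+1, v)).
Qed.

(** Right linearity of [T] turns the mixed terms into $(Tv)(s + \bar s) = 2\mathrm{Re}(s)\,Tv$. *)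
Lemma Qs_factor v :
  Qs s T v = rm QX (rm QX v s - T v) (qconj s) - T (rm QX v s - T v).
Proof.
rewrite -/(rscale QX (qconj s) _) !linearB /= /rscale -rmA qmul_conj rm_real.
rewrite Trm opprK /Qs -[in LHS](rm_real QX (2 * _)) -qadd_conj rmDr opprD.
rewrite addrC -[RHS]addrA; congr (_ + _).
by rewrite [LHS]addrC [X in X + _ = _]addrC -addrA.
Qed.

Lemma Qs_rm v q : Qs s T (rm QX v q) = rm QX (Qs s T v) q.
Proof.
rewrite /Qs -[rm QX (_ + _) q]/(rscale QX q _) linearD linearB /=.
by rewrite !Trm !linearZ.
Qed.

End PowerBounded.

(** * The exterior of the unit ball lies in the spherical resolvent set *)

Section SphericalResolventSet.
Variables (R : realType) (X : completeNormedModType R) (QX : qbanach X).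
Variables (T : {linear X -> X}) (M : R).
Hypothesis Trm : forall v q, T (rm QX v q) = rm QX (T v) q.
Hypotheses (M0 : 0 <= M) (hM : forall n, opbound (iter n T) M).

(** Both factors of $Q_s(T)$ are surjective and bounded below, hence so is $Q_s(T)$. Preimages
    picked by choice form the inverse, and injectivity transfers additivity and right linearity to
    it. *)
Lemma in_rhoS_power_bounded s : 1 < qnorm s -> in_rhoS QX s T.
Proof.
move=> hs.
have [K K0 [Ksurj Kle]] := right_resolvent Trm M0 hM hs.
have hs' : 1 < qnorm (qconj s) by rewrite qnorm_conj.
have [L L0 [Lsurj Lle]] := right_resolvent Trm M0 hM hs'.
have Qle v : `|v| <= K * L * `|Qs s T v|.
  apply: le_trans (Kle v) _; rewrite -mulrA ler_wpM2l // (Qs_factor Trm).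
  exact: Lle.
have /choice[B BK] w : exists v, Qs s T v = w.
  have [u <-] := Lsurj w; have [v <-] := Ksurj u.
  by exists v; rewrite (Qs_factor Trm).
have QD u v : Qs s T (u + v) = Qs s T u + Qs s T v.
    by rewrite /Qs !linearD /= -[RHS]addrACA; congr (_ + _); rewrite addrACA.
  have QB u v : Qs s T (u - v) = Qs s T u - Qs s T v.
    rewrite /Qs !linearB !opprD /= -[RHS]addrACA; congr (_ + _).
    by rewrite addrACA.
  have Qinj u v : Qs s T u = Qs s T v -> u = v.
  move=> e; apply/eqP; rewrite -subr_eq0 -normr_le0.
  by apply: le_trans (Qle _) _; rewrite QB e subrr normr0 mulr0.
exists B; split; last by split=> v //; apply: Qinj.
split=> [u v|]; first by apply: Qinj; rewrite QD !BK.
split=> [v q|]; first by apply: Qinj; rewrite (Qs_rm Trm) !BK.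
by exists (K * L) => v; rewrite -{2}(BK v).
Qed.

End SphericalResolventSet.

(** * Yosida approximations at real points *)

Section RealPoint.
Variables (R : realType) (X : completeNormedModType R) (QX : qbanach X).
Variables (T : {linear X -> X}) (r : R).

Definition shift_op v := r *: v - T v.

Lemma shift_op_linear : linear shift_op.
Proof.
move=> a u v; rewrite /shift_op [T _]linearP scalerDr opprD addrACA.
by rewrite !scalerA mulrC -scalerA -scalerBr.
Qed.

HB.instance Definition _ :=
  GRing.isLinear.Build R X X *:%R shift_op shift_op_linear.

(** At a real point $\bar s = r$ commutes with [T], so the formal power becomes a genuine one. *)
Lemma numL_qreal n v : numL QX T (qreal r) n v = iter n shift_op v.
Proof.
elim: n v => [|n IH] v; first by rewrite numL0.
by rewrite numLS qconj_qreal lm_real !IH linearZ.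
Qed.

Lemma numR_qreal n v : numR QX T (qreal r) n v = iter n shift_op v.
Proof.
elim: n v => [|n IH] v; first by rewrite numR0.
by rewrite numRS qconj_qreal lm_real !IH iterSr -linearZ -linearB.
Qed.

Hypothesis r0 : 0 <= r.

Lemma Qs_qreal v : Qs (qreal r) T v = shift_op (shift_op v).
Proof.
rewrite /Qs qnorm_qreal // /shift_op scalerBr.
rewrite [T (_ - _)]linearB [T (_ *: _)]linearZ /=.
rewrite scalerA opprD opprK -expr2 addrC -[RHS]addrA; congr (_ + _).
by rewrite mulr_natl mulr2n scalerDl opprD [LHS]addrC -addrA.
Qed.

Lemma shift_op_comm v : T (shift_op v) = shift_op (T v).
Proof. by rewrite /shift_op linearB /= linearZ. Qed.

Lemma iter_shift_op_le K n v : 0 <= K -> opbound T K ->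
  `|iter n shift_op v| <= (r + K) ^+ n * `|v|.
Proof.
move=> K0 hK; elim: n => [|n IH]; first by rewrite mul1r.
rewrite exprS -mulrA; apply: le_trans (ler_wpM2l (addr_ge0 r0 K0) IH).
apply: le_trans (ler_normB _ _) _.
by rewrite normrZ ger0_norm // mulrDl lerD.
Qed.

Variable Qi : {linear X -> X}.
Hypotheses (QK : cancel (Qs (qreal r) T) Qi) (QiK : cancel Qi (Qs (qreal r) T)).

Let iterQK n v : iter n Qi (iter n shift_op (iter n shift_op v)) = v.
Proof.
rewrite -(iter_comp (A := shift_op)) //; apply: (iter_cancel n _) => u.
by rewrite /= -Qs_qreal QK.
Qed.

(** Evaluation at $(r-T)^n v$ keeps the inverse of $r - T$ out of the formula: the numerator
    supplies another $(r-T)^n$, and $Q_r(T)^{-n}$ cancels both. *)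
Lemma YL_qreal n v :
  YLn QX Qi n (qreal r) T (iter n shift_op v) = r ^+ n *: iter n T v.
Proof.
rewrite /YLn /SLn -/(numL QX T (qreal r) n _) numL_qreal qexp_qreal lm_real.
by rewrite !linearZ /= iterQK.
Qed.

Lemma YR_qreal n v :
  YRn QX Qi n (qreal r) T (iter n shift_op v) = r ^+ n *: iter n T v.
Proof.
rewrite /YRn /SRn -/(numR QX T (qreal r) n _) numR_qreal qexp_qreal lm_real.
(* Here the inverses stand between the two powers of $r - T$; commutation brings them outside, as
   [iterQK] requires. *)
have EQ u : shift_op (Qi u) = Qi (shift_op u).
  by apply: (inverse_comm QK QiK) => w; rewrite !Qs_qreal.
have TE u : T (iter n shift_op u) = iter n shift_op (T u).
  by apply: iter_comm; exact: shift_op_comm.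
rewrite -(iter_comm n (A := iter n shift_op)) => [|u]; last by rewrite TE.
have EQn u : iter n shift_op (Qi u) = Qi (iter n shift_op u).
  by rewrite -(iter_comm n (A := Qi)).
by rewrite (iter_comm n _ EQn) iterQK.
Qed.

End RealPoint.

(** Division by $r^n$ gives $a(1-1/r)^n \le b(1+K/r)^n$, and both powers tend to 1. *)
Lemma limit_at_infinity (R : realType) (a b K : R) n :
  (forall r, 1 < r -> r ^+ n * a <= b / (1 - 1 / r) ^+ n * (r + K) ^+ n) ->
  a <= b.
Proof.
move=> h.
have lim c : ((1 + c * harmonic k.+1) ^+ n @[k --> \oo] --> (1 : R))%classic.
  have hl : (1 + c * harmonic k.+1 @[k --> \oo] --> (1 + c * 0 : R))%classic.
    apply: cvgD; first exact: cvg_cst.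
    apply: cvgM; first exact: cvg_cst.
    by have := @cvg_harmonic R; rewrite -cvg_shiftS.
  rewrite mulr0 addr0 in hl.
  elim: n {h} => [|n IH].
    by under eq_fun do rewrite expr0; exact: cvg_cst.
  under eq_fun do rewrite exprS.
  by rewrite -[X in nbhs X]mulr1; exact: cvgM hl IH.
have la : (a * (1 + (-1) * harmonic k.+1) ^+ n @[k --> \oo] --> a * 1)%classic.
  by apply: cvgM (lim _); exact: cvg_cst.
have lb : (b * (1 + K * harmonic k.+1) ^+ n @[k --> \oo] --> b * 1)%classic.
  by apply: cvgM (lim _); exact: cvg_cst.
rewrite -[a]mulr1 -[b]mulr1; apply: ler_cvg_to la lb _; apply: nearW => k.
(* The sample points $r = k+2$ exceed 1, and [harmonic k.+1] is $1/(k+2)$. *)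
have := h k.+2%:R; rewrite ltr1n => /(_ isT) /=.
rewrite mulN1r; set t := k.+2%:R^-1.
have t0 : 0 < k.+2%:R :> R by rewrite ltr0n.
have t1 : 0 < 1 - t by rewrite subr_gt0 invf_lt1 // ltr1n.
have -> : k.+2%:R + K = k.+2%:R * (1 + K * t).
  by rewrite mulrDr mulr1 mulrCA mulfV ?mulr1 // gt_eqF.
rewrite exprMn mul1r mulrCA ler_pM2l ?exprn_gt0 // -/t.
by rewrite mulrAC ler_pdivlMr ?exprn_gt0.
Qed.

(** * Equivalence of power-boundedness with each of the two Yosida bounds *)

Theorem theorem3p7 (R : realType) (X : completeNormedModType R)
  (QX : qbanach X) (T : X -> X) (hT : is_bop QX T) :
  (* (i) <-> (ii) *)
      ((exists M : R, forall n : nat, (0 < n)%N -> opbound (iter n T) M) <->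
       ((forall s : quat R, 1 < qnorm s -> in_rhoS QX s T) /\
        exists C : R, 0 < C /\
          forall (s : quat R) (Qinv : X -> X) (n : nat),
            1 < qnorm s -> is_inverse QX (Qs s T) Qinv -> (0 < n)%N ->
            opbound (YLn QX Qinv n s T) (C / (1 - 1 / qnorm s) ^+ n))) /\
      (* (i) <-> (iii) *)
      ((exists M : R, forall n : nat, (0 < n)%N -> opbound (iter n T) M) <->
       ((forall s : quat R, 1 < qnorm s -> in_rhoS QX s T) /\
        exists C : R, 0 < C /\
          forall (s : quat R) (Qinv : X -> X) (n : nat),
            1 < qnorm s -> is_inverse QX (Qs s T) Qinv -> (0 < n)%N ->
            opbound (YRn QX Qinv n s T) (C / (1 - 1 / qnorm s) ^+ n))).
Proof.
have Trm := hT.2.1; have Tb := bop_bounded hT.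
pose T' : {linear X -> X} :=
  HB.pack T (GRing.isLinear.Build R X X *:%R T (bop_linear hT)).
have powers : (exists M : R, forall n, (0 < n)%N -> opbound (iter n T) M) ->
    exists2 M : R, 0 < M & forall n, opbound (iter n T) M.
  (* The maximum with 1 covers $T^0$, on which the assumption is silent, and makes the constant
     positive. *)
  move=> [M hM]; exists (Num.max 1 M); first by rewrite lt_max ltr01.
  case=> [v|n]; first by rewrite ler_peMl // le_max lexx.
  by apply: opbound_le (hM n.+1 _) => //; rewrite le_max lexx orbT.
have lin s Qi : is_inverse QX (Qs s T) Qi -> exists2 Qi' : {linear X -> X},
    Qi = Qi' & bounded_op Qi /\ cancel (Qs s T') Qi' /\ cancel Qi' (Qs s T').
  move=> [Qb [QK QiK]]; have hb := bop_bounded Qb.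
  pose Qi' : {linear X -> X} :=
    HB.pack Qi (GRing.isLinear.Build R X X *:%R Qi (bop_linear Qb)).
  by exists Qi'.
(* The converse for both approximations at once: only their common value at real points enters. *)
have back (Y : (X -> X) -> nat -> quat R -> X -> X) :
    (forall (r : R) (Qi : {linear X -> X}) n v, 0 <= r ->
       cancel (Qs (qreal r) T') Qi -> cancel Qi (Qs (qreal r) T') ->
       Y Qi n (qreal r) (iter n (shift_op T' r) v) = r ^+ n *: iter n T v) ->
    (forall s, 1 < qnorm s -> in_rhoS QX s T) ->
    forall C : R, 0 < C -> (forall s Qi n,
      1 < qnorm s -> is_inverse QX (Qs s T) Qi -> (0 < n)%N ->
      opbound (Y Qi n s) (C / (1 - 1 / qnorm s) ^+ n)) ->
    exists M : R, forall n : nat, (0 < n)%N -> opbound (iter n T) M.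
  move=> Yreal rho C C0 hC; exists C => n n0 v.
  have [K K0 hK] := Tb.
  apply: (@limit_at_infinity _ _ _ K n) => r r1.
  have r0 : 0 < r by apply: lt_trans r1.
  have nr : qnorm (qreal r) = r by rewrite qnorm_qreal // ltW.
  have hr : 1 < qnorm (qreal r) by rewrite nr.
  have [Qi hQi] := rho _ hr.
  have [Qi' eQ [_ [QK QiK]]] := lin _ _ hQi.
  (* The bound is tested on $(r-T)^n v$, whose norm is at most $(r+K)^n |v|$. *)
  have := hC _ _ n hr hQi n0 (iter n (shift_op T' r) v).
  rewrite nr eQ (Yreal _ _ _ _ (ltW r0) QK QiK) normrZ.
  rewrite ger0_norm ?exprn_ge0 ?(ltW r0) //.
  move=> /le_trans; apply.
  have r1' : 0 < 1 - 1 / r by rewrite subr_gt0 mul1r invf_lt1.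
  rewrite [C * _ / _]mulrAC -[leRHS]mulrA ler_wpM2l //.
    by rewrite divr_ge0 ?exprn_ge0 // ltW.
  by rewrite [leRHS]mulrC; apply: iter_shift_op_le => //; exact: ltW.
split; split.
- move=> /powers[M M0 hM]; split=> [s hs|].
    exact: (in_rhoS_power_bounded (T := T') Trm (ltW M0) hM hs).
  exists M; split=> // s Qi n hs hQi _ v.
  have [Qi' -> [hb [QK QiK]]] := lin _ _ hQi.
  rewrite mul1r.
  (* The case $j = 0$ of the bound on $T^j Y_L^n v$. *)
  exact: (YL_bound (T := T') QX Tb (ltW M0) hM hs n hb QK QiK (0, v)).
- move=> [rho [C [C0 hC]]].
  apply: (back (fun Qi n s => YLn QX Qi n s T)) hC => //.
  by move=> r Qi n v r0 QK QiK; exact: (YL_qreal (T := T') QX r0 QK).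
- move=> /powers[M M0 hM]; split=> [s hs|].
    exact: (in_rhoS_power_bounded (T := T') Trm (ltW M0) hM hs).
  exists M; split=> // s Qi n hs hQi _ v.
  have [Qi' -> [hb [QK QiK]]] := lin _ _ hQi.
  rewrite mul1r.
  exact: (YR_bound (T := T') QX Tb hM hs n hb QK QiK (0, v)).
- move=> [rho [C [C0 hC]]].
  apply: (back (fun Qi n s => YRn QX Qi n s T)) hC => //.
  by move=> r Qi n v r0 QK QiK; exact: (YR_qreal (T := T') QX r0 QK QiK).
Qed.
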